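(* Let $K$ be a field, $A$ an associative (not necessarily commutative) unital $K$-algebra, $I\subseteq A$ a left ideal, $F=\{f_1,\ldots,f_m\}\subseteq A$ a set of pairwise commuting elements, and $S\subseteq A$ the multiplicative monoid generated by $F$, where $0\notin S$. Consider the following algorithm. (1) Let $\psi:K[t_1,\ldots,t_m]\to A$ be the $K$-algebra homomorphism with $t_i\mapsto f_i$. (2) Compute $L:=\psi^{-1}(I)\subseteq K[t_1,\ldots,t_m]$. (3) If $\psi(L)=0$, return $\emptyset$. (4) Let $R:=K[t_1,\ldots,t_m]/\ker(\psi)$ and let $M$ be the biggest monomial ideal of $R$ contained in the ideal $L/\ker(\psi)$ of $R$. (5) If $M=\{0\}$, return $\emptyset$; otherwise return $M$ (given by finitely many monomial generators). This algorithm correctly computes $I\cap S$: if it returns $\emptyset$ then $I\cap S=\emptyset$, and if it returns $M$ then $I\cap S$ is nonempty and consists exactly of the elements $f_1^{\alpha_1}\cdots f_m^{\alpha_m}$ with $\alpha\in\mathbb{N}_0^m$ such that the residue class of $t_1^{\alpha_1}\cdots t_m^{\alpha_m}$ in $R$ lies in $M$. Furthermore, the termination of the algorithm depends solely on the termination of the computation of $\psi^{-1}(I)$: whenever that computation terminates, so does the algorithm.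
   Context: A monomial ideal of a quotient $R=K[t]/\mathfrak{a}$ of a polynomial ring is an ideal generated by residue classes of monomials $t^\alpha$; the biggest monomial ideal contained in an ideal of $R$ is the ideal generated by all residue classes of monomials lying in that ideal, and it is computed by a terminating Gröbner basis procedure. Since $K[t_1,\ldots,t_m]$ is commutative, the preimage of the left ideal $I$ under $\psi$ is an ideal of $K[t_1,\ldots,t_m]$. *)

(* Defs.v *)
From HB Require Import structures.
From mathcomp Require Import all_boot all_order all_algebra.
From mathcomp Require Export mpoly.

Set Implicit Arguments.
Unset Strict Implicit.
Unset Printing Implicit Defensive.

Import Order.TTheory GRing.Theory.

Local Open Scope ring_scope.
Local Open Scope quotient_scope.

(* Subsets are Prop-valued predicates: membership in an ideal need not be
   decidable. *)

Section Ideals.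
Variable R : nzRingType.

(* For commutative R these are the ideals of R. *)
Definition left_ideal (J : R -> Prop) : Prop :=
  [/\ J 0, forall x y, J x -> J y -> J (x + y) & forall a x, J x -> J (a * x)].

Definition left_ideal_gen (G : R -> Prop) (x : R) : Prop :=
  forall J, left_ideal J -> (forall g, G g -> J g) -> J x.

Inductive monoid_gen (m : nat) (f : 'I_m -> R) : R -> Prop :=
  | monoid_gen1 : monoid_gen f 1
  | monoid_gen_in i : monoid_gen f (f i)
  | monoid_genM x y : monoid_gen f x -> monoid_gen f y -> monoid_gen f (x * y).

Definition pairwise_commuting (m : nat) (f : 'I_m -> R) : Prop :=
  forall i j, f i * f j = f j * f i.

End Ideals.

(* Possibly nonterminating computations, as the delay monad: a computation
   halts iff it consists of finitely many [later] steps followed by [now]. *)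

CoInductive delay (X : Type) : Type :=
  | now of X
  | later of delay X.
Arguments now {X}.
Arguments later {X}.

Inductive returns (X : Type) : delay X -> X -> Prop :=
  | returns_now x : returns (now x) x
  | returns_later c x : returns c x -> returns (later c) x.

Definition halts (X : Type) (c : delay X) : Prop := exists x, returns c x.

CoFixpoint bind (X Y : Type) (c : delay X) (k : X -> delay Y) : delay Y :=
  match c with
  | now x => k x
  | later c' => later (bind c' k)
  end.

CoFixpoint iterate (St X : Type) (step : St -> St + X) (s : St) : delay X :=
  match step s with
  | inl s' => later (iterate step s')
  | inr x => now x
  end.

Section Psi.
Variables (K : fieldType) (A : algType K) (m : nat) (f : 'I_m -> A).

(* The product defining [mmap] is taken in the order of the indices; it is a
   homomorphism as soon as the [f i] commute pairwise, see [psiM]. *)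
Definition psi (p : {mpoly K[m]}) : A := mmap (in_alg A) f p.

Lemma psi_monom a : psi 'X_[a] = \prod_(i < m) f i ^+ a i.
Proof. by rewrite /psi mmapX. Qed.

Lemma psi1 : psi 1 = 1.
Proof. by rewrite -(mpolyX0 m K) psi_monom big1 // => i _; rewrite mnm0E expr0. Qed.

Lemma psiX i : psi 'X_i = f i.
Proof. by rewrite /psi mmapX mmap1U. Qed.

Lemma psiD : {morph psi : p q / p + q}.
Proof. exact: mmapD. Qed.

Lemma psi0 : psi 0 = 0.
Proof. exact: mmap0. Qed.

Lemma psiZ c : {morph psi : p / c *: p}.
Proof. by move=> p; rewrite /psi mmapZ mulr_algl. Qed.

Hypothesis hf : pairwise_commuting f.

Lemma psi_monomD a b : psi 'X_[a + b] = psi 'X_[a] * psi 'X_[b].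
Proof.
rewrite !psi_monom; pose F i := f i ^+ a i * f i ^+ b i.
rewrite (eq_bigr F) => [|i _]; last by rewrite mnmDE exprD.
rewrite {}/F.
suff H (s : seq 'I_m) : \prod_(i <- s) (f i ^+ a i * f i ^+ b i) =
    (\prod_(i <- s) f i ^+ a i) * \prod_(i <- s) f i ^+ b i by exact: H.
elim: s => [|i s IHs]; first by rewrite !big_nil mulr1.
rewrite !big_cons IHs -!mulrA; congr (_ * _); rewrite !mulrA; congr (_ * _).
have comm_prod : GRing.comm (f i ^+ b i) (\prod_(j <- s) f j ^+ a j).
  by apply: commr_prod => j _; apply: commrX; apply/commr_sym/commrX/hf.
exact: comm_prod.
Qed.

Lemma psiM : {morph psi : p q / p * q}.
Proof.
have psi_sum (T : Type) (s : seq T) (F : T -> {mpoly K[m]}) :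
    psi (\sum_(i <- s) F i) = \sum_(i <- s) psi (F i).
  exact: (big_morph psi psiD psi0).
move=> p q; rewrite [p in LHS]mpolyE [q in LHS]mpolyE mulr_suml psi_sum.
rewrite [p in RHS]mpolyE psi_sum mulr_suml; apply: eq_bigr => a _.
rewrite mulr_sumr psi_sum [q in RHS]mpolyE psi_sum mulr_sumr.
apply: eq_bigr => b _; rewrite -scalerAl -scalerAr -mpolyXD !psiZ psi_monomD.
by rewrite -scalerAl -scalerAr.
Qed.

(* The proof argument makes the ideal structure below inferable. *)
Definition ker_psi of pairwise_commuting f : {pred {mpoly K[m]}} :=
  fun p => psi p == 0.

Lemma ker_psi_idealr : idealr_closed (ker_psi hf).
Proof.
split; rewrite ?unfold_in ?/ker_psi ?psi0 ?psi1 ?oner_eq0 //.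
move=> p u v; rewrite !unfold_in /ker_psi psiD psiM => /eqP-> /eqP->.
by rewrite mulr0 addr0.
Qed.

HB.instance Definition _ :=
  isIdealr.Build {mpoly K[m]} (ker_psi hf) ker_psi_idealr.

Definition R_psi : comNzRingType := {ideal_quot (ker_psi hf)}.

Definition residue (p : {mpoly K[m]}) : R_psi := \pi_({ideal_quot (ker_psi hf)}) p.

Definition monomial_ideal_gen (E : 'X_{1..m} -> Prop) : R_psi -> Prop :=
  left_ideal_gen (fun x => exists2 a, E a & x = residue 'X_[a]).

Definition monomial_ideal (M : R_psi -> Prop) : Prop :=
  exists E, forall x, M x <-> monomial_ideal_gen E x.

Definition biggest_monomial_ideal (J M : R_psi -> Prop) : Prop :=
  [/\ monomial_ideal M, forall x, M x -> J x
    & forall N, monomial_ideal N -> (forall x, N x -> J x) ->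
        forall x, N x -> M x].

(* The image of L in R_psi; this is L / ker psi when ker psi is contained
   in L. *)
Definition ideal_residues (L : {mpoly K[m]} -> Prop) (x : R_psi) : Prop :=
  exists2 p, L p & x = residue p.

(* A terminating procedure which, given generators of an ideal L containing
   ker psi, returns (exponents of) monomials whose residue classes generate
   the biggest monomial ideal contained in L / ker psi. *)
Definition biggest_monomial_ideal_procedure
    (bmi : seq {mpoly K[m]} -> delay (seq 'X_{1..m})) : Prop :=
  forall Ls : seq {mpoly K[m]},
    let L := left_ideal_gen (fun g => g \in Ls) in
    (forall p, p \in ker_psi hf -> L p) ->
    halts (bmi Ls) /\
    forall E, returns (bmi Ls) E ->
      biggest_monomial_ideal (ideal_residues L)
                             (monomial_ideal_gen (fun a => a \in E)).

End Psi.

(* A possibly nonterminating computation of generators of the ideal L. *)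
Definition computes_generators (K : fieldType) (m : nat)
    (c : delay (seq {mpoly K[m]})) (L : {mpoly K[m]} -> Prop) : Prop :=
  forall Ls, returns c Ls -> forall p, L p <-> left_ideal_gen (fun g => g \in Ls) p.

(* [None] encodes the answer "empty set"; [Some E] encodes the ideal M
   generated by the residue classes of the monomials with exponents in E.
   As psi is linear and multiplicative, psi(L) = 0 iff psi kills the
   generators of L, and M = {0} iff the generating monomials lie in ker psi. *)
Definition intersect_monoid (K : fieldType) (A : algType K) (m : nat)
    (f : 'I_m -> A) (preimage : delay (seq {mpoly K[m]}))
    (bmi : seq {mpoly K[m]} -> delay (seq 'X_{1..m})) :
    delay (option (seq 'X_{1..m})) :=
  bind preimage (fun Ls =>
    if all (fun g => psi f g == 0) Ls then now None else
    bind (bmi Ls) (fun E =>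
      if all (fun a => psi f 'X_[a] == 0) E then now None else now (Some E))).

Section Buchberger.
Variables (K : fieldType) (n : nat) (block : pred 'I_n).
Implicit Types (a b : 'X_{1..n}) (p q g : {mpoly K[n]}).

(* Elimination order for the variables in [block]: the degree in these
   variables is compared first, ties are broken by the library's
   degree-based order. *)
Definition block_deg a : nat := \sum_(i < n | block i) a i.

Definition elim_le a b : bool :=
  (block_deg a < block_deg b)%N
  || (block_deg a == block_deg b) && (a <= b)%O.

Definition elim_lead p : 'X_{1..n} :=
  foldr (fun a b => if elim_le b a then a else b) 0%MM (msupp p).

Definition elim_leadc p : K := p@_(elim_lead p).

Definition spoly p q : {mpoly K[n]} :=
  let a := elim_lead p in let b := elim_lead q in
  elim_leadc q *: ('X_[mlcm a b - a] * p)
  - elim_leadc p *: ('X_[mlcm a b - b] * q).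

(* State (p, G, B): G is the basis built so far, B the list of critical pairs
   still to be treated, p the polynomial being top-reduced modulo G. *)
Definition buchberger_state : Type :=
  {mpoly K[n]} * seq {mpoly K[n]} * seq ({mpoly K[n]} * {mpoly K[n]}).

Definition buchberger_step (s : buchberger_state) :
    buchberger_state + seq {mpoly K[n]} :=
  let: (p, G, B) := s in
  if p == 0 then
    match B with
    | [::] => inr G
    | (g, h) :: B' => inl (spoly g h, G, B')
    end
  else
    match [seq g <- G | (elim_lead g <= elim_lead p)%MM] with
    | g :: _ =>
        inl (p - (elim_leadc p / elim_leadc g)
                 *: ('X_[elim_lead p - elim_lead g] * g), G, B)
    | [::] => inl (0, p :: G, [seq (p, g) | g <- G] ++ B)
    end.

Definition buchberger (gs : seq {mpoly K[n]}) : delay (seq {mpoly K[n]}) :=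
  let G := [seq g <- gs | g != 0] in
  iterate buchberger_step (0, G, [seq (g, h) | g <- G, h <- G]).

End Buchberger.

(* Biggest monomial ideal of an ideal L of K[t_1, .., t_m].  In the variables
   t_1, .., t_m, z, y_1, .., y_m, the ideal generated by z y_1 ... y_m - 1 and
   by the g(y_1 t_1, .., y_m t_m), for g in a generating set of L, meets
   K[t_1, .., t_m] in the span of the monomials of L.  This intersection is
   computed by eliminating z, y_1, .., y_m; being a monomial ideal, it is
   generated by the monomials occurring in its generators. *)
Section BiggestMonomialIdeal.
Variables (K : fieldType) (m : nat).

Definition tvar (i : 'I_m) : 'I_(m + m.+1) := lshift m.+1 i.
Definition zvar : 'I_(m + m.+1) := rshift m ord0.
Definition yvar (i : 'I_m) : 'I_(m + m.+1) := rshift m (lift ord0 i).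

Definition yzblock : pred 'I_(m + m.+1) := fun i => (m <= i)%N.

Definition twist (g : {mpoly K[m]}) : {mpoly K[m + m.+1]} :=
  mmap (@mpolyC (m + m.+1) K) (fun i => 'X_(yvar i) * 'X_(tvar i)) g.

Definition yz_unit : {mpoly K[m + m.+1]} :=
  'X_zvar * \prod_(i < m) 'X_(yvar i) - 1.

Definition groebner_bmi (Ls : seq {mpoly K[m]}) : delay (seq 'X_{1..m}) :=
  bind (buchberger yzblock (yz_unit :: [seq twist g | g <- Ls])) (fun G =>
    now (flatten
      [seq [seq [multinom a (tvar i) | i < m] | a : 'X_{1..m + m.+1} <- msupp g]
      | g : {mpoly K[m + m.+1]} <- G
      & all (fun a => block_deg yzblock a == 0)%N (msupp g)])).

End BiggestMonomialIdeal.

(* Main.v *)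
From HB Require Import structures.
Require Import Defs.
From mathcomp Require Import all_boot all_order all_algebra ssrcomplements.
From Stdlib Require Import Classical IndefiniteDescription.

(** The elements of [S] are the values [psi 'X_[a]], so [I] meets [S] exactly in
the values of the monomials of [L], the preimage of [I].  As [L] contains
[ker psi], a monomial lies in [L] iff its residue class lies in [L / ker psi],
iff that class lies in the biggest monomial ideal [M] of [L / ker psi]
([monom_in_biggest]).  So [M] describes the intersection.  Both tests for the
answer [None] are sound because [psi 'X_[a]], an element of [S], is never zero:
if [psi] kills the generators of [L], or the generators of [M], it kills every
monomial of [L], hence there is none.

What remains is that the biggest monomial ideal is computed by a terminating
Groebner basis procedure.

Buchberger's algorithm.  Call a sum of multiples [X^b g], with [g] in a list
[G], bounded by [P] if [P] holds for all the exponents [b + lead g]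
([lead_rep]).  If each S-polynomial of [G] is such a sum bounded strictly by
the lcm of the two leading monomials, then in any such sum with bound [c] the
terms that reach [c] can be merged into one by S-polynomials; so either that
single term survives, and then it carries the leading monomial of the sum, or
the bound can be lowered.  The order being well-founded, each nonzero element
of the ideal has its leading monomial divisible by that of an element of [G]
([buchberger_criterion]).  The hypothesis on S-polynomials is, up to the pairs
not treated yet, an invariant of the algorithm ([buchberger_correct]).  The
algorithm halts because each new element of the basis has a leading monomial
that no former one divides, which by Dickson's lemma happens finitely often,
and between two such events the list of pairs shrinks, or the leading monomial
of the polynomial being reduced decreases ([buchberger_halts]).

The auxiliary variables.  Let [J] be the ideal generated by [z y_1 .. y_m - 1]
and the twists [g(y_1 t_1, .., y_m t_m)] of the generators of [L].  Give [y_i]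
weight [e_i], [t_i] weight [- e_i] and [z] weight [- (e_1 + .. + e_m)]: the
generators [z y_1 .. y_m - 1] and [g(y t)] are then homogeneous of weight 0.
Keeping the terms of a given weight and setting all [y_i] and [z] to 1 is a
map [tcomp] that sends [J] into [L] ([tcomp_ideal]).  On a polynomial in [t]
alone, distinct monomials have distinct weights, so [tcomp] isolates each of
them: all the monomials of an element of [J] free of [y] and [z] are in [L].
Conversely, if [t^a] is in [L] then [y^a t^a] is in [J], and so is [t^a] since
the [y_i] are invertible modulo [J] ([monom_twist_ideal]).  Then some basis
element has a leading monomial dividing [t^a]; the elimination order forces
that element to be free of [y] and [z], so that its leading monomial is one of
the exponents returned ([groebner_bmi_correct]). *)

Set Implicit Arguments.
Unset Strict Implicit.
Unset Printing Implicit Defensive.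

Import Order.TTheory GRing.Theory.
Local Open Scope ring_scope.

(** * Ideals and possibly nonterminating computations *)

Lemma left_ideal_gen_ideal (R : nzRingType) (G : R -> Prop) :
  left_ideal (left_ideal_gen G).
Proof.
split=> [J [J0 _ _] _ //|x y Gx Gy J idJ sGJ|a x Gx J idJ sGJ]; case: (idJ) => _ JD JM.
  by apply: JD; [apply: Gx|apply: Gy].
by apply: JM; apply: Gx.
Qed.

Section Delay.
Variable X : Type.

(** Forces one step of a cofixpoint, which does not reduce by itself. *)
Lemma delay_eta (c : delay X) :
  c = match c with now x => now x | later c' => later c' end.
Proof. by case: c. Qed.

Lemma returns_nowE (x y : X) : returns (now x) y -> y = x.
Proof. by move=> ret; inversion ret. Qed.

End Delay.

Lemma bind_now (X Y : Type) (x : X) (k : X -> delay Y) : bind (now x) k = k x.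
Proof. by rewrite [LHS]delay_eta /=; case: (k x). Qed.

Lemma bind_later (X Y : Type) c (k : X -> delay Y) :
  bind (later c) k = later (bind c k).
Proof. by rewrite [LHS]delay_eta. Qed.

Lemma returns_bind (X Y : Type) c (k : X -> delay Y) x y :
  returns c x -> returns (k x) y -> returns (bind c k) y.
Proof.
elim=> [{}x|{}c {}x _ IH] /=; first by rewrite bind_now.
by move/IH; rewrite bind_later; apply: returns_later.
Qed.

Lemma returns_bindE (X Y : Type) c (k : X -> delay Y) y :
  returns (bind c k) y -> exists2 x, returns c x & returns (k x) y.
Proof.
move Ed: (bind c k) => d ret; elim: ret c Ed => {d y} [y|d y ret IH] [x|c].
- by rewrite bind_now => kx; exists x; [|rewrite kx]; apply: returns_now.
- by rewrite bind_later.
- rewrite bind_now => kx; exists x; first exact: returns_now.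
  by rewrite kx; apply: returns_later.
- rewrite bind_later => -[/IH[x cx kx]].
  by exists x => //; apply: returns_later.
Qed.

Lemma iterateE (St X : Type) (step : St -> St + X) s :
  iterate step s =
  match step s with inl s' => later (iterate step s') | inr x => now x end.
Proof. by rewrite [LHS]delay_eta /=; case: (step s). Qed.

Lemma halts_iterate (St X : Type) (step : St -> St + X) s s' :
  step s = inl s' -> halts (iterate step s') -> halts (iterate step s).
Proof.
by move=> ss' [x ret]; exists x; rewrite iterateE ss'; apply: returns_later.
Qed.

Lemma iterate_invariant (St X : Type) (step : St -> St + X) (Inv : St -> Prop) s x :
  (forall s s', Inv s -> step s = inl s' -> Inv s') ->
  Inv s -> returns (iterate step s) x -> exists2 s', Inv s' & step s' = inr x.
Proof.
move=> Inv_step; move Ed: (iterate step s) => d Is ret.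
elim: ret s Ed Is => {d x} [x|d x ret IH] s; rewrite iterateE;
  case step_s: (step s) => [s'|y] //; case.
- by move=> yx Is; exists s; rewrite // step_s yx.
- by move=> d_s' Is; apply: (IH s') => //; apply: Inv_step step_s.
Qed.

(** * Dickson's lemma *)

(** Every tail of a sequence of naturals attains its minimum; jump repeatedly to
an index at which the minimum of the remaining tail is attained. *)
Lemma nondecreasing_subsequence (u : nat -> nat) :
  exists2 phi : nat -> nat, {homo phi : i j / (i < j)%N}
    & {homo u \o phi : i j / (i <= j)%N}.
Proof.
have tail_min N : exists i, (N <= i)%N /\ forall j, (i <= j)%N -> (u i <= u j)%N.
  move Ev: (u N) => v; elim/ltn_ind: v N Ev => v IHv N uN.
  have [minN|] := classic (forall j, (N <= j)%N -> (u N <= u j)%N).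
    by exists N.
  move=> nmin; have [j nminj] := not_all_ex_not _ _ nmin.
  have [leNj /negP] := imply_to_and _ _ nminj; rewrite -ltnNge uN.
  case/IHv/(_ j erefl) => i [leji mini]; exists i; split=> //.
  exact: leq_trans leji.
have [m mP] := functional_choice _ tail_min.
pose phi k := iter k (fun i => m i.+1) (m 0).
have phiS k : (phi k < phi k.+1)%N by case: (mP (phi k).+1).
exists phi; first by apply: homo_ltn => //; apply: ltn_trans.
apply: homo_leq => [//|j i k|k /=]; first exact: leq_trans.
have min_phi : forall j, (phi k <= j)%N -> (u (phi k) <= u j)%N.
  by case: k => [|k]; [case: (mP 0) | case: (mP (phi k).+1)].
exact/min_phi/ltnW.
Qed.

(** Extract a subsequence that is nondecreasing in one coordinate, and repeat for
the other coordinates: the monotonicity already achieved is inherited. *)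
Lemma dickson n (u : nat -> 'X_{1..n}) :
  exists i j, (i < j)%N /\ (u i <= u j)%MM.
Proof.
have [phi phi_incr phiP] : exists2 phi : nat -> nat, {homo phi : i j / (i < j)%N}
    & forall c, c \in enum 'I_n -> {homo (fun i => u (phi i) c) : i j / (i <= j)%N}.
  elim: (enum 'I_n) => [|c s [phi phi_incr phiP]]; first by exists id.
  have [chi chi_incr chiP] := nondecreasing_subsequence (fun i => u (phi i) c).
  exists (phi \o chi) => [i j /chi_incr/phi_incr//|d].
  rewrite inE => /orP[/eqP-> //|/phiP mono_d] i j leij; apply: mono_d.
  by move: leij; rewrite leq_eqVlt => /orP[/eqP->|/chi_incr/ltnW].
exists (phi 0), (phi 1); split; first exact: phi_incr.
by apply/mnm_lepP => c; apply: phiP => //; rewrite mem_enum.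
Qed.

(** The way in which the list of leading monomials grows in Buchberger's
algorithm. *)
Definition irredundant_ext n (s' s : seq 'X_{1..n}) :=
  exists2 a, ~~ has (fun b => (b <= a)%MM) s & s' = a :: s.

(** The monomials added along an infinite chain of extensions would be a sequence
in which none divides a later one. *)
Lemma irredundant_ext_wf n : well_founded (@irredundant_ext n).
Proof.
move=> s0; apply: NNPP => nacc0; pose bad := {s | ~ Acc (@irredundant_ext n) s}.
have next (s : bad) : exists t : bad, irredundant_ext (sval t) (sval s).
  apply: NNPP => no_next; case: (svalP s); constructor=> t ext_ts.
  by apply: NNPP => nacct; case: no_next; exists (exist _ t nacct).
have [f fP] := functional_choice _ next.
pose s k := sval (iter k f (exist _ s0 nacc0)).
have ext k : irredundant_ext (s k.+1) (s k) by apply: fP.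
pose a k := head 0%MM (s k.+1).
have sS k : s k.+1 = a k :: s k by rewrite /a; case: (ext k) => b _ ->.
have a_in i j : (i < j)%N -> a i \in s j.
  elim: j => // j IHj; rewrite ltnS leq_eqVlt sS inE => /orP[/eqP->|/IHj->].
    by rewrite eqxx.
  by rewrite orbT.
have [i [j [ltij leij]]] := dickson a.
have [b /hasPn nodiv] := ext j; rewrite sS => [[eq_b]].
by move: (nodiv _ (a_in i j ltij)) => /=; rewrite -eq_b leij.
Qed.
(** * The elimination order *)

Section ElimOrder.
Variables (n : nat) (block : pred 'I_n).
Implicit Types a b c : 'X_{1..n}.

Local Notation le := (elim_le block).
Local Notation deg := (block_deg block).

Definition elim_lt a b : bool := ~~ le b a.
Local Notation lt := elim_lt.

Lemma block_degD a b : deg (a + b)%MM = (deg a + deg b)%N.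
Proof. by rewrite /block_deg -big_split; apply: eq_bigr => i _; rewrite mnmDE. Qed.

Lemma block_deg_le a b : (a <= b)%MM -> (deg a <= deg b)%N.
Proof. by move/mnm_lepP => leab; apply: leq_sum => i _. Qed.

Lemma elim_le_refl : reflexive le.
Proof. by move=> a; rewrite /elim_le eqxx lexx orbT. Qed.

Lemma elim_le_total : total le.
Proof. by move=> a b; rewrite /elim_le; case: ltngtP => //= _; apply: le_total. Qed.

Lemma elim_le_trans : transitive le.
Proof.
move=> b a c; rewrite /elim_le.
case: (ltngtP (deg a) (deg b)) => //= [ltab|->] /=.
  by move=> _ /orP[/(ltn_trans ltab)->//|/andP[/eqP<- _]]; rewrite ltab.
by move=> leab /orP[->//|/andP[-> lebc]]; rewrite (le_trans leab lebc) orbT.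
Qed.

Lemma elim_le_anti : antisymmetric le.
Proof.
move=> a b; rewrite /elim_le.
by case: (ltngtP (deg a) (deg b)) => //= _; apply: le_anti.
Qed.

Lemma elim_leD2l c a b : le (c + a)%MM (c + b)%MM = le a b.
Proof. by rewrite /elim_le !block_degD ltn_add2l eqn_add2l lemc_add2r. Qed.

Lemma elim_ltD2l c a b : lt (c + a)%MM (c + b)%MM = lt a b.
Proof. by rewrite /lt elim_leD2l. Qed.

Lemma elim_le0m a : le 0%MM a.
Proof.
rewrite /elim_le /block_deg big1 => [|i _]; last by rewrite mnm0E.
by rewrite le0m andbT; case: (\sum_(_ < _ | _) _)%N.
Qed.

Lemma elim_le_deg a b : le a b -> (deg a <= deg b)%N.
Proof. by move=> /orP[/ltnW//|/andP[/eqP-> _]]. Qed.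

Lemma elim_ltW a b : lt a b -> le a b.
Proof. by rewrite /lt; case/orP: (elim_le_total a b) => ->. Qed.

Lemma elim_le_lt_trans a b c : le a b -> lt b c -> lt a c.
Proof.
by rewrite /lt => leab; apply: contra => leca; apply: elim_le_trans leab.
Qed.

Lemma elim_lt_neqAle a b : lt a b = (a != b) && le a b.
Proof.
rewrite /lt; case: eqVneq => [->|neab] /=; first by rewrite elim_le_refl.
apply/idP/idP; first exact: elim_ltW.
apply: contraL => leba; apply: contra neab => leab.
by rewrite (@elim_le_anti a b) // leab leba.
Qed.

(** Lexicographic product of the block degree and of the library's order, both of
which are well-founded. *)
Lemma elim_wf : well_founded lt.
Proof.
move=> a; move: {2}(deg a) (erefl (deg a)) => d.
elim/ltn_ind: d a => d IHd a; elim/(well_founded_ind (@ltom_wf n)): a.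
move=> a IHa da; constructor=> b; rewrite elim_lt_neqAle.
case/andP=> neba /orP[|/andP[/eqP db leba]].
  by rewrite da => /IHd; apply.
by apply: IHa; rewrite -?da // lt_neqAle neba.
Qed.

End ElimOrder.

(** * Leading monomials *)

Section Lead.
Variables (K : fieldType) (n : nat) (block : pred 'I_n).
Implicit Types (a b c : 'X_{1..n}) (p q g h : {mpoly K[n]}).

Local Notation le := (elim_le block).
Local Notation lt := (elim_lt block).
Local Notation lead := (elim_lead block).
Local Notation leadc := (elim_leadc block).

Lemma elim_lead0 : lead (0 : {mpoly K[n]}) = 0%MM.
Proof. by rewrite /elim_lead msupp0. Qed.

(** The default 0 of the fold defining the leading monomial is the least monomial,
so it never wins against a monomial of the support. *)
Lemma elim_lead_supp p : p != 0 -> lead p \in msupp p.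
Proof.
rewrite -msupp_eq0 /elim_lead; case: (msupp p) => //= a s _.
elim: s a => [|b s IHs] a /=; first by rewrite elim_le0m inE.
have := IHs b; rewrite /=; set t := if le _ b then _ else _ => tin.
by case: ifP => _; rewrite !inE ?eqxx // -in_cons tin orbT.
Qed.

Lemma elim_le_lead p a : a \in msupp p -> le a (lead p).
Proof.
rewrite /elim_lead; elim: (msupp p) => //= b s IHs.
rewrite inE => /orP[/eqP->|/IHs las]; case: ifP => // lesb.
- exact: elim_le_refl.
- set c := foldr _ _ _ in lesb *.
  by have := elim_le_total block b c; rewrite lesb orbF.
- exact: elim_le_trans lesb.
Qed.

Lemma elim_lead_le p c : (forall a, a \in msupp p -> le a c) -> le (lead p) c.
Proof.
have [->|/elim_lead_supp pin] := eqVneq p 0; last exact.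
by rewrite elim_lead0 elim_le0m.
Qed.

Lemma elim_leadc_eq0 p : (leadc p == 0) = (p == 0).
Proof.
apply/idP/eqP => [|->]; last by rewrite /elim_leadc mcoeff0.
by rewrite /elim_leadc mcoeff_eq0; apply: contraNeq => /elim_lead_supp.
Qed.

Lemma elim_leadP p c :
  p@_c != 0 -> (forall a, a \in msupp p -> le a c) -> lead p = c.
Proof.
rewrite -mcoeff_msupp => cin lec; apply: (@elim_le_anti _ block).
by rewrite elim_lead_le // elim_le_lead.
Qed.

Lemma elim_lead_lt p c :
  (forall a, a \in msupp p -> le a c) -> p@_c = 0 -> p != 0 -> lt (lead p) c.
Proof.
move=> lec pc /elim_lead_supp lp; rewrite elim_lt_neqAle lec // andbT.
by apply: contraTneq lp => ->; rewrite mcoeff_msupp pc eqxx.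
Qed.

Lemma mcoeffXM p b a : ('X_[b] * p)@_(b + a) = p@_a.
Proof. by rewrite mulrC mcoeffMX. Qed.

Lemma mcoeffXM_sub p a c : (a <= c)%MM -> ('X_[c - a] * p)@_c = p@_a.
Proof. by move=> leac; rewrite -{1}(submK leac) mcoeffXM. Qed.

Lemma msuppXM_le p b c : le (b + lead p)%MM c ->
  forall a, a \in msupp ('X_[b] * p) -> le a c.
Proof.
move=> lec a; rewrite mulrC (perm_mem (msuppMX p b)) => /mapP[d din ->].
by apply: elim_le_trans lec; rewrite elim_leD2l elim_le_lead.
Qed.

Lemma msuppZ_elim_le (k : K) p c :
  (forall a, a \in msupp p -> le a c) -> forall a, a \in msupp (k *: p) -> le a c.
Proof. by move=> lec a /msuppZ_le; apply: lec. Qed.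

Lemma msuppD_elim_le p q c :
  (forall a, a \in msupp p -> le a c) -> (forall a, a \in msupp q -> le a c) ->
  forall a, a \in msupp (p + q) -> le a c.
Proof. by move=> lep leq a /msuppD_le; rewrite mem_cat => /orP[/lep|/leq]. Qed.

Lemma msuppB_elim_le p q c :
  (forall a, a \in msupp p -> le a c) -> (forall a, a \in msupp q -> le a c) ->
  forall a, a \in msupp (p - q) -> le a c.
Proof. by move=> lep leq a /msuppB_le; rewrite mem_cat => /orP[/lep|/leq]. Qed.

(** Both multiples have leading monomial the lcm, and the scalars are chosen to
make these leading terms cancel. *)
Lemma spoly_lead_lt p q :
  spoly block p q != 0 -> lt (lead (spoly block p q)) (mlcm (lead p) (lead q)).
Proof.
have lep := lem_mlcml (lead p) (lead q); have leq := lem_mlcmr (lead p) (lead q).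
apply: elim_lead_lt.
  apply: msuppB_elim_le; apply: msuppZ_elim_le; apply: msuppXM_le;
    by rewrite submK // elim_le_refl.
rewrite mcoeffB !mcoeffZ !mcoeffXM_sub //.
by rewrite -!/(elim_leadc block _) mulrC subrr.
Qed.

Definition reductum p g :=
  p - (leadc p / leadc g) *: ('X_[lead p - lead g] * g).

Lemma reductum_lead_lt p g : g != 0 -> (lead g <= lead p)%MM ->
  reductum p g != 0 -> lt (lead (reductum p g)) (lead p).
Proof.
rewrite -elim_leadc_eq0 => g0 legp; apply: elim_lead_lt.
  apply: msuppB_elim_le; first exact: elim_le_lead.
  by apply: msuppZ_elim_le; apply: msuppXM_le; rewrite submK // elim_le_refl.
rewrite mcoeffB mcoeffZ mcoeffXM_sub //.
by rewrite -!/(elim_leadc block _) divfK // subrr.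
Qed.

End Lead.

(** * Buchberger's criterion *)

Section Buchberger.
Variables (K : fieldType) (n : nat) (block : pred 'I_n).
Implicit Types (a b c : 'X_{1..n}) (p q g h : {mpoly K[n]}).
Implicit Types (G H : seq {mpoly K[n]}) (P Q : 'X_{1..n} -> Prop).

Local Notation le := (elim_le block).
Local Notation lt := (elim_lt block).
Local Notation lead := (elim_lead block).
Local Notation leadc := (elim_leadc block).
Local Notation spoly := (spoly block).

(** Sums of multiples of elements of [G] whose leading exponents satisfy [P]; for
[P := lt^~ c] this is a representation below [c], for [P := fun=> True] mere
membership in the ideal. *)
Inductive lead_rep G P : {mpoly K[n]} -> Prop :=
  | lead_rep0 : lead_rep G P 0
  | lead_rep_add k b g p : g \in G -> P (b + lead g)%MM -> lead_rep G P p ->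
      lead_rep G P (k *: ('X_[b] * g) + p).

Lemma lead_rep_term G P k b g :
  g \in G -> P (b + lead g)%MM -> lead_rep G P (k *: ('X_[b] * g)).
Proof. by move=> gG Pg; rewrite -[_ *: _]addr0; apply: lead_rep_add (lead_rep0 _ _). Qed.

Lemma lead_repD G P p q : lead_rep G P p -> lead_rep G P q -> lead_rep G P (p + q).
Proof.
move=> repp repq; elim: repp => [|k b g p' gG Pg _ IH]; first by rewrite add0r.
by rewrite -addrA; apply: lead_rep_add.
Qed.

Lemma lead_repZ G P k p : lead_rep G P p -> lead_rep G P (k *: p).
Proof.
elim=> [|k' b g p' gG Pg _ IH]; first by rewrite scaler0; apply: lead_rep0.
by rewrite scalerDr scalerA; apply: lead_rep_add.
Qed.

Lemma lead_rep_trans G P H Q p :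
  (forall b g, g \in G -> P (b + lead g)%MM -> lead_rep H Q ('X_[b] * g)) ->
  lead_rep G P p -> lead_rep H Q p.
Proof.
move=> repG; elim=> [|k b g p' gG Pg _ IH]; first exact: lead_rep0.
by apply: lead_repD IH; apply: lead_repZ; apply: repG.
Qed.

Lemma lead_rep_sub G P H Q p :
  {subset G <= H} -> (forall c, P c -> Q c) -> lead_rep G P p -> lead_rep H Q p.
Proof.
move=> sGH sPQ; apply: lead_rep_trans => b g /sGH gH /sPQ Qg.
by rewrite -['X_[b] * g]scale1r; apply: lead_rep_term.
Qed.

Lemma lead_repXM G P Q b p :
  (forall c, P c -> Q (b + c)%MM) -> lead_rep G P p -> lead_rep G Q ('X_[b] * p).
Proof.
move=> sPQ; elim=> [|k d g p' gG Pg _ IH]; first by rewrite mulr0; apply: lead_rep0.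
rewrite mulrDr -scalerAr mulrA -mpolyXD; apply: lead_rep_add => //.
by rewrite -addmA; apply: sPQ.
Qed.

(** A finite sum has a largest leading exponent, by totality of the order. *)
Lemma lead_rep_bound G P p : lead_rep G P p ->
  p = 0 \/ exists2 c, P c & lead_rep G (fun a => le a c) p.
Proof.
elim=> [|k b g q gG Pg _ [->|[c Pc repq]]]; [by left| |]; right.
  exists (b + lead g)%MM => //; apply: lead_rep_add (lead_rep0 _ _) => //.
  exact: elim_le_refl.
have [lecg|legc] := orP (elim_le_total block c (b + lead g)%MM).
  exists (b + lead g)%MM => //; apply: lead_rep_add => //; first exact: elim_le_refl.
  by apply: lead_rep_sub repq => // a /elim_le_trans; apply.
by exists c => //; apply: lead_rep_add.
Qed.

Lemma lead_rep_lt_msupp G c p a :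
  lead_rep G (fun a => lt a c) p -> a \in msupp p -> lt a c.
Proof.
move=> repp; elim: repp a => [|k b g q gG ltgc _ IH] a; first by rewrite msupp0.
move/msuppD_le; rewrite mem_cat => /orP[/msuppZ_le ain|/IH//].
by apply: elim_le_lt_trans ltgc; apply: msuppXM_le ain; apply: elim_le_refl.
Qed.

Lemma lead_rep_ideal G : left_ideal (lead_rep G (fun=> True)).
Proof.
split=> [|p q|a p repp]; [exact: lead_rep0|exact: lead_repD|].
elim/mpolyind: a => [|k b q _ _ IH]; first by rewrite mul0r; apply: lead_rep0.
rewrite mulrDl -scalerAl; apply: lead_repD IH; apply: lead_repZ.
exact: lead_repXM repp.
Qed.

Section Criterion.
Variable G : seq {mpoly K[n]}.
Hypothesis G0 : 0 \notin G.
Hypothesis repS : forall g h, g \in G -> h \in G ->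
  lead_rep G (fun a => lt a (mlcm (lead g) (lead h))) (spoly g h).

Let leadc_neq0 g : g \in G -> leadc g != 0.
Proof. by rewrite elim_leadc_eq0; apply: contraTneq => ->. Qed.

(** Two multiples with the same leading monomial [c] cancel up to a multiple of
the S-polynomial: [c] is a multiple of the lcm, and shifting a representation
below the lcm gives one below [c]. *)
Lemma lead_rep_cancel c b g d h : g \in G -> h \in G ->
  (b + lead g)%MM = c -> (d + lead h)%MM = c ->
  lead_rep G (fun a => lt a c)
    ('X_[b] * g - (leadc g / leadc h) *: ('X_[d] * h)).
Proof.
move=> gG hG bc dc; set l := mlcm (lead g) (lead h).
have lelc : (l <= c)%MM by rewrite lem_mlcm -{1}bc -dc !lem_addl.
have shift e f : (e + f)%MM = c -> (f <= l)%MM ->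
    'X_[e] = 'X_[c - l] * 'X_[l - f] :> {mpoly K[n]}.
  move=> efc lefl; rewrite -mpolyXD; congr 'X_[_].
  by apply: (@addIm _ f); rewrite -addmA submK // submK.
have -> : 'X_[b] * g - (leadc g / leadc h) *: ('X_[d] * h)
        = (leadc h)^-1 *: ('X_[c - l] * spoly g h).
  rewrite /Defs.spoly mulrBr -!scalerAr !mulrA.
  rewrite -(shift _ _ bc) ?lem_mlcml // -(shift _ _ dc) ?lem_mlcmr //.
  by rewrite scalerBr !scalerA mulVf ?leadc_neq0 // scale1r [leadc g / _]mulrC.
apply: lead_repZ; apply: lead_repXM (repS gG hG) => a.
by rewrite -{2}(submK lelc) elim_ltD2l.
Qed.

(** Merge the terms reaching the bound [c] one by one: by [lead_rep_cancel], any of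
them is a scalar multiple of any other, up to terms below [c]. *)
Lemma lead_rep_top c p : lead_rep G (fun a => le a c) p ->
  lead_rep G (fun a => lt a c) p \/
  exists k b g, [/\ g \in G, (b + lead g)%MM = c &
    lead_rep G (fun a => lt a c) (p - k *: ('X_[b] * g))].
Proof.
elim=> [|k b g q gG lebgc _ IH]; first by left; apply: lead_rep0.
have [bgc|nbgc] := eqVneq (b + lead g)%MM c; last first.
  have ltbgc : lt (b + lead g)%MM c by rewrite elim_lt_neqAle nbgc.
  case: IH => [repq|[k' [d [h [hG dhc repq]]]]].
    by left; apply: lead_rep_add.
  by right; exists k', d, h; split=> //; rewrite -addrA; apply: lead_rep_add.
right; case: IH => [repq|[k' [d [h [hG dhc repq]]]]].
  by exists k, b, g; split=> //; rewrite addrC addKr.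
exists (k' + k * (leadc g / leadc h)), d, h; split=> //.
have -> : k *: ('X_[b] * g) + q - (k' + k * (leadc g / leadc h)) *: ('X_[d] * h)
    = k *: ('X_[b] * g - (leadc g / leadc h) *: ('X_[d] * h))
      + (q - k' *: ('X_[d] * h)).
  by rewrite scalerBr scalerA scalerDl opprD [RHS]addrACA [- _ - k' *: _]addrC.
by apply: lead_repD repq; apply: lead_repZ; apply: lead_rep_cancel.
Qed.

(** Well-founded induction on a bound [c] of a representation of [p].  If the term
at [c] is absent or has a zero coefficient, the bound can be lowered;
otherwise it is the leading term of [p]. *)
Lemma buchberger_criterion p : lead_rep G (fun=> True) p -> p != 0 ->
  exists2 g, g \in G & (lead g <= lead p)%MM.
Proof.
move=> repp p0; have [p00|[c _ {}repp]] := lead_rep_bound repp.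
  by rewrite p00 eqxx in p0.
elim/(well_founded_ind (elim_wf block)): c p repp p0 => c IHc p repp p0.
have lower : lead_rep G (fun a => lt a c) p ->
    exists2 g, g \in G & (lead g <= lead p)%MM.
  case/lead_rep_bound=> [p00|[c' ltc'c repp']]; first by rewrite p00 eqxx in p0.
  exact: IHc ltc'c _ repp' p0.
have [|[k [b [g [gG bgc repr]]]]] := lead_rep_top repp; first exact: lower.
have [k0|k0] := eqVneq k 0.
  by apply: lower; move: repr; rewrite k0 scale0r subr0.
exists g => //; set r := p - _ in repr.
have pE : p = k *: ('X_[b] * g) + r by rewrite addrC subrK.
have rc : r@_c = 0.
  apply/eqP; rewrite mcoeff_eq0; apply/negP => /(lead_rep_lt_msupp repr).
  by rewrite /elim_lt elim_le_refl.
suff -> : lead p = c by rewrite -bgc lem_addl.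
apply: elim_leadP.
  by rewrite pE mcoeffD rc addr0 mcoeffZ -bgc mcoeffXM mulf_neq0 // leadc_neq0.
rewrite pE; apply: msuppD_elim_le => [|a /(lead_rep_lt_msupp repr)]; last first.
  exact: elim_ltW.
by apply: msuppZ_elim_le; apply: msuppXM_le; rewrite bgc elim_le_refl.
Qed.

End Criterion.

(** * Buchberger's algorithm *)

Lemma lead_rep_self P G p :
  P (lead p) -> p \in G -> lead_rep G P p.
Proof.
move=> Pp pG; rewrite -[p]mul1r -mpolyX0 -[_ * p]scale1r.
by apply: lead_rep_term; rewrite ?add0m.
Qed.

(** A reduction step on [p] preserves representations over [p :: G]: replace [p]
by its reductum plus the multiple of [g] subtracted, whose leading exponent is
that of [p]. *)
Lemma lead_rep_reductum G c p g :
  g \in G -> g != 0 -> (lead g <= lead p)%MM ->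
  forall q, lead_rep (p :: G) (fun a => lt a c) q ->
  lead_rep (reductum block p g :: G) (fun a => lt a c) q.
Proof.
move=> gG g0 legp; set r := reductum block p g.
(* A zero reductum has leading exponent 0, the least one. *)
have ler : le (lead r) (lead p).
  have [->|r0] := eqVneq r 0; first by rewrite elim_lead0 elim_le0m.
  exact/elim_ltW/reductum_lead_lt.
move=> q; apply: lead_rep_trans => b h; rewrite inE => /orP[/eqP->|hG] ltbc.
  have -> : 'X_[b] * p =
      'X_[b] * r + (leadc p / leadc g) *: ('X_[b + (lead p - lead g)] * g).
    by rewrite mpolyXD -mulrA scalerAr -mulrDr subrK.
  rewrite -['X_[b] * r]scale1r.
  apply: lead_repD; apply: lead_rep_term; rewrite ?inE ?eqxx ?gG ?orbT //.
    by apply: elim_le_lt_trans ltbc; rewrite elim_leD2l.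
  by rewrite -addmA submK.
by rewrite -['X_[b] * h]scale1r; apply: lead_rep_term; rewrite // inE hG orbT.
Qed.

Lemma lead_rep_cons0 P G p : lead_rep (0 :: G) P p -> lead_rep G P p.
Proof.
apply: lead_rep_trans => b g; rewrite inE => /orP[/eqP->|gG] Pg.
  by rewrite mulr0; apply: lead_rep0.
by rewrite -['X_[b] * g]scale1r; apply: lead_rep_term.
Qed.

Lemma spolyC p q : spoly q p = - spoly p q.
Proof. by rewrite /Defs.spoly opprB [mlcm (lead q) _]mlcmC. Qed.

(** Trades the filtered list inspected by the algorithm, of which only the head is
used, for a divisor in [G] or the absence of one. *)
Lemma buchberger_step_divisor p G B : 0 \notin G -> p != 0 ->
  (exists2 g, g \in G /\ (lead g <= lead p)%MM
    & buchberger_step block (p, G, B) = inl (reductum block p g, G, B)) \/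
  ~~ has (fun g => (lead g <= lead p)%MM) G /\
  buchberger_step block (p, G, B) = inl (0, p :: G, [seq (p, g) | g <- G] ++ B).
Proof.
move=> G0 /negPf p0; rewrite /= p0.
case Ed: [seq g <- G | (lead g <= lead p)%MM] => [|g s].
  by right; rewrite has_filter Ed.
have : g \in [seq g <- G | (lead g <= lead p)%MM] by rewrite Ed mem_head.
by rewrite mem_filter => /andP[legp gG]; left; exists g.
Qed.

(** The termination measure is lexicographic: the leading monomials of [G] for
[irredundant_ext], then the list of pairs, then the leading monomial of the
polynomial being reduced. *)
Lemma iterate_buchberger_halts G (B : seq ({mpoly K[n]} * {mpoly K[n]})) p :
  0 \notin G -> halts (iterate (buchberger_step block) (p, G, B)).
Proof.
move: {2}(map lead G) (erefl (map lead G)) => s.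
elim/(well_founded_ind (@irredundant_ext_wf n)): s G p B => s IHs G p B Gs G0.
have reduce B' : halts (iterate (buchberger_step block) (0, G, B')) ->
    forall q, halts (iterate (buchberger_step block) (q, G, B')).
  move=> halt0 q; have [->//|] := eqVneq q 0; move: {2}(lead q) (erefl (lead q)) => a.
  elim/(well_founded_ind (elim_wf block)): a q => a IHa q qa q0.
  have [[g [gG legq] step_q]|[nodiv step_q]] := buchberger_step_divisor B' G0 q0.
    apply: (halts_iterate step_q); have [->//|r0] := eqVneq (reductum block q g) 0.
    apply: (IHa _ _ _ erefl r0); rewrite -qa; apply: reductum_lead_lt => //.
    by apply: contraNneq G0 => <-.
  apply: (halts_iterate step_q); apply: (IHs _ _ _ _ _ erefl); rewrite -?Gs.
    by exists (lead q); rewrite // has_map.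
  by rewrite inE negb_or eq_sym q0.
elim: B p => [|[g h] B IHB] p; apply: reduce.
  by exists G; rewrite iterateE /= eqxx; apply: returns_now.
by apply: halts_iterate (IHB (spoly g h)); rewrite /= eqxx.
Qed.

Lemma buchberger_halts (gs : seq {mpoly K[n]}) : halts (buchberger block gs).
Proof. by apply: iterate_buchberger_halts; rewrite mem_filter eqxx. Qed.

Lemma ideal_mpolyZ (J : {mpoly K[n]} -> Prop) k p :
  left_ideal J -> J p -> J (k *: p).
Proof. by case=> _ _ JM Jp; rewrite -mul_mpolyC; apply: JM. Qed.

Lemma ideal_mpolyB (J : {mpoly K[n]} -> Prop) p q :
  left_ideal J -> J p -> J q -> J (p - q).
Proof. by case=> _ JD JM Jp Jq; rewrite -mulN1r; apply/JD/JM. Qed.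

Lemma buchberger_correct (gs G : seq {mpoly K[n]}) :
  returns (buchberger block gs) G ->
  let J := left_ideal_gen (fun g => g \in gs) in
  (forall g, g \in G -> J g) /\
  (forall p, J p -> p != 0 -> exists2 g, g \in G /\ g != 0 & (lead g <= lead p)%MM).
Proof.
rewrite /buchberger; set G0 := [seq g <- gs | _] => ret /=.
set J := left_ideal_gen _; have idJ : left_ideal J := left_ideal_gen_ideal _.
have [J0 JD JM] := idJ.
have Jgs : forall g, g \in gs -> J g by move=> g ggs I _; apply.
have Jmin I : left_ideal I -> (forall g, g \in gs -> I g) -> forall q, J q -> I q.
  by move=> idI sgsI q; apply.
(* The S-polynomial of a pair that is neither waiting in [B] nor the current one
   has been reduced to 0 or to an element added to the basis; the S-polynomial of the current pair is represented with the help of the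
   polynomial [p] being reduced, hence the [p :: H] below. *)
clearbody J; pose Inv (s : buchberger_state K n) := let: (p, H, B) := s in
  [/\ 0 \notin H, {subset G0 <= H}, J p /\ (forall g, g \in H -> J g),
      forall x, x \in B -> x.1 \in H /\ x.2 \in H
    & forall g h, g \in H -> h \in H -> [\/ (g, h) \in B, (h, g) \in B |
        lead_rep (p :: H) (fun a => lt a (mlcm (lead g) (lead h))) (spoly g h)]].
(* Invariance: popping a pair, a reduction step, then an extension of the basis. *)
have Inv_step s s' : Inv s -> buchberger_step block s = inl s' -> Inv s'.
  case: s => [[p H] B] [H0 sG0H [Jp JH] BH repB].
  have [p0|p0] := eqVneq p 0.
    rewrite {}p0 /= eqxx in repB *; case: B BH repB => //= -[g h] B BH repB [<-].
    have [/= gH hH] := BH _ (mem_head _ _).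
    split=> //; first split=> //.
    - by apply: (ideal_mpolyB idJ); apply: (ideal_mpolyZ _ idJ); apply/JM/JH.
    - by move=> x xB; apply: BH; rewrite inE xB orbT.
    have rep_gh :
        lead_rep (spoly g h :: H) (fun a => lt a (mlcm (lead g) (lead h))) (spoly g h).
      have [->|s0] := eqVneq (spoly g h) 0; first exact: lead_rep0.
      by apply: lead_rep_self; [apply: spoly_lead_lt|apply: mem_head].
    have rep_hg :
        lead_rep (spoly g h :: H) (fun a => lt a (mlcm (lead h) (lead g))) (spoly h g).
      by rewrite mlcmC (spolyC g h) -scaleN1r; apply: lead_repZ.
    move=> g' h' g'H h'H; case: (repB g' h' g'H h'H).
    - rewrite inE => /orP[/eqP[-> ->]|]; last by constructor 1.
      by constructor 3.
    - rewrite inE => /orP[/eqP[-> ->]|]; last by constructor 2.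
      by constructor 3.
    move/lead_rep_cons0=> rep; constructor 3; apply: lead_rep_sub rep => // f.
    by move=> fH; rewrite inE fH orbT.
  have [[g [gH legp] ->]|[nodiv ->]] := buchberger_step_divisor B H0 p0 => -[<-].
    have g0 : g != 0 by apply: contraNneq H0 => <-.
    split=> //; first split=> //.
      by apply: (ideal_mpolyB idJ) => //; apply: (ideal_mpolyZ _ idJ); apply/JM/JH.
    move=> g' h' g'H h'H; case: (repB g' h' g'H h'H).
    - by constructor 1.
    - by constructor 2.
    by constructor 3; apply: lead_rep_reductum.
  split.
  - by rewrite inE negb_or eq_sym p0.
  - by move=> g /sG0H gH; rewrite inE gH orbT.
  - by split=> // g; rewrite inE => /orP[/eqP->|/JH].
  - move=> x; rewrite mem_cat => /orP[/mapP[g gH ->]|/BH[]] /=;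
      rewrite !inE ?eqxx ?gH ?orbT //.
    by move=> -> ->; rewrite !orbT.
  move=> g h; rewrite !inE.
  have newB f : f \in H -> (p, f) \in [seq (p, g) | g <- H] ++ B.
    by move=> fH; rewrite mem_cat map_f.
  case/orP=> [/eqP->|gH] /orP[/eqP->|hH].
  - by constructor 3; rewrite /Defs.spoly subrr; apply: lead_rep0.
  - by constructor 1; apply: newB.
  - by constructor 2; apply: newB.
  case: (repB g h gH hH) => [ghB|hgB|rep].
  - by constructor 1; rewrite mem_cat ghB orbT.
  - by constructor 2; rewrite mem_cat hgB orbT.
  by constructor 3; apply: lead_rep_sub rep => // f fH; rewrite inE fH orbT.
have Inv0 : Inv (0, G0, [seq (g, h) | g <- G0, h <- G0]).
  split=> //; first by rewrite mem_filter eqxx.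
  - by split=> // g; rewrite mem_filter => /andP[_ /Jgs].
  - by move=> x /allpairsP[[g h] [gG0 hG0 ->]].
  by move=> g h gG0 hG0; constructor 1; apply/allpairsP; exists (g, h).
have [[[p H] B] [H0 sG0H [_ JH] _ repB]] := iterate_invariant Inv_step Inv0 ret.
rewrite /=; case: eqVneq repB => [->|_ _]; last by case: [seq _ <- _ | _].
case: B => [repB [<-]|[]//]; split=> // q Jq q0.
have repS g h : g \in H -> h \in H ->
    lead_rep H (fun a => lt a (mlcm (lead g) (lead h))) (spoly g h).
  by move=> gH hH; case: (repB g h gH hH) => // /lead_rep_cons0.
have repq : lead_rep H (fun=> True) q.
  apply: (Jmin _ _ _ q Jq) => [|g ggs]; first exact: lead_rep_ideal.
  have [->|g0] := eqVneq g 0; first exact: lead_rep0.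
  by apply: lead_rep_self => //; apply: sG0H; rewrite mem_filter g0.
have [g gH legq] := buchberger_criterion H0 repS repq q0.
by exists g => //; split=> //; apply: contraNneq H0 => <-.
Qed.

End Buchberger.

(** * The twisted ideal *)

Section LinearExtension.
Variables (K : fieldType) (n : nat) (V : lmodType K) (phi : 'X_{1..n} -> V).
Implicit Types p q : {mpoly K[n]}.

Definition monom_lin p : V := \sum_(u <- msupp p) p@_u *: phi u.

Lemma monom_lin_bounded k p : (msize p <= k)%N ->
  monom_lin p = \sum_(u : 'X_{1..n < k}) p@_u *: phi u.
Proof.
move=> lepk; rewrite /monom_lin (big_mksub 'X_{1..n < k}) ?msupp_uniq //=.
  by rewrite big_rmcond //= => u /memN_msupp_eq0->; rewrite scale0r.
by move=> u /msize_mdeg_lt /leq_trans; apply.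
Qed.

Lemma monom_lin_is_linear : linear monom_lin.
Proof.
move=> k p q; set N := maxn (msize (k *: p + q)) (maxn (msize p) (msize q)).
rewrite !(@monom_lin_bounded N) ?leq_max ?leqnn ?orbT //.
rewrite scaler_sumr -big_split; apply: eq_bigr => u _.
by rewrite mcoeffD mcoeffZ scalerDl scalerA.
Qed.

HB.instance Definition _ :=
  GRing.isLinear.Build K {mpoly K[n]} V _ monom_lin monom_lin_is_linear.

Lemma monom_linX u : monom_lin 'X_[u] = phi u.
Proof. by rewrite /monom_lin msuppX big_seq1 mcoeffX eqxx scale1r. Qed.

End LinearExtension.

Section Twist.
Variables (K : fieldType) (m : nat).
Implicit Types (a b : 'X_{1..m}) (u v : 'X_{1..m + m.+1}) (i : 'I_m).
Implicit Types (g : {mpoly K[m]}) (p q : {mpoly K[m + m.+1]}).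

Local Notation t := (@tvar m).
Local Notation z := (@zvar m).
Local Notation y := (@yvar m).

(** The exponent of the part in [t_1, .., t_m] of a monomial. *)
Definition tpart u : 'X_{1..m} := [multinom u (t i) | i < m].

(** The exponent of [t^a z^k y^b]. *)
Definition tzy a (k : nat) b : 'X_{1..m + m.+1} :=
  [multinom match split j with
            | inl i => a i
            | inr j' => oapp (fun i => b i) k (unlift ord0 j')
            end | j < m + m.+1].

Lemma tzy_t a k b i : tzy a k b (t i) = a i.
Proof. by rewrite mnmE (unsplitK (inl _ i)). Qed.

Lemma tzy_z a k b : tzy a k b z = k.
Proof. by rewrite mnmE (unsplitK (inr _ ord0)) unlift_none. Qed.

Lemma tzy_y a k b i : tzy a k b (y i) = b i.
Proof. by rewrite mnmE (unsplitK (inr _ (lift ord0 i))) liftK. Qed.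

Definition tzyE := (tzy_t, tzy_z, tzy_y).

Lemma tzyP u v : (forall i, u (t i) = v (t i)) -> u z = v z ->
  (forall i, u (y i) = v (y i)) -> u = v.
Proof.
move=> ut uz uy; apply/mnmP => j; case: (split_ordP j) => [i ->|j' ->]; first exact: ut.
by case: (unliftP ord0 j') => [i ->|->]; [apply: uy|apply: uz].
Qed.

Lemma tzyD a k b a' k' b' :
  (tzy a k b + tzy a' k' b')%MM = tzy (a + a')%MM (k + k') (b + b')%MM.
Proof. by apply: tzyP => [i||i]; rewrite mnmDE !tzyE ?mnmDE. Qed.

Lemma tpart_tzy a k b : tpart (tzy a k b) = a.
Proof. by apply/mnmP => i; rewrite mnmE tzy_t. Qed.

Lemma tpartD u v : tpart (u + v)%MM = (tpart u + tpart v)%MM.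
Proof. by apply/mnmP => i; rewrite mnmDE !mnmE. Qed.

Lemma yzblock_deg0 u : block_deg (@yzblock m) u = 0%N -> u = tzy (tpart u) 0 0%MM.
Proof.
move/eqP; rewrite sum_nat_eq0 => /forallP u0.
have uyz j : u (rshift m j) = 0%N.
  by apply/eqP/(implyP (u0 _)); rewrite /yzblock /= leq_addr.
by apply: tzyP => [i||i]; rewrite tzyE ?mnmE //; apply: uyz.
Qed.

Lemma tpart_deg0 a : block_deg (@yzblock m) (tzy a 0 0%MM) = 0%N.
Proof.
apply: big1 => j; case: (split_ordP j) => [i ->|j' -> _].
  by rewrite /yzblock /= leqNgt ltn_ord.
by case: (unliftP ord0 j') => [i ->|->]; rewrite tzyE ?mnm0E.
Qed.

Lemma twistX a : twist 'X_[K, a] = 'X_[tzy a 0 a].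
Proof.
rewrite /twist mmapX /mmap1.
under eq_bigr => i _ do rewrite -mpolyXD.
rewrite mprodXnE; congr 'X_[_].
have eqtt i j : (t i == t j) = (i == j) by rewrite eq_lshift.
have eqyt i j : (y i == t j) = false by rewrite eq_rlshift.
have eqyy i j : (y i == y j) = (i == j) by rewrite eq_rshift (inj_eq lift_inj).
have eqty i j : (t i == y j) = false by rewrite eq_lrshift.
have eqtz i : (t i == z) = false by rewrite eq_lrshift.
have eqyz i : (y i == z) = false by rewrite eq_rshift.
apply: tzyP => [i||i]; rewrite mnm_sumE tzyE.
- rewrite (bigD1 i) //= big1 => [|j nij]; rewrite mulmnE mnmDE !mnm1E eqyt eqtt.
    by rewrite eqxx mul1n addn0.
  by rewrite (negPf nij).
- by apply: big1 => j _; rewrite mulmnE mnmDE !mnm1E eqyz eqtz.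
- rewrite (bigD1 i) //= big1 => [|j nij]; rewrite mulmnE mnmDE !mnm1E eqty eqyy.
    by rewrite eqxx mul1n addn0.
  by rewrite (negPf nij).
Qed.

Lemma yz_unitE : @yz_unit K m = 'X_[tzy 0 1 [multinom 1%N | _ < m]] - 1.
Proof.
rewrite /yz_unit mprodXE -mpolyXD; congr ('X_[_] - 1).
have eqyt i j : (y i == t j) = false by rewrite eq_rlshift.
have eqyy i j : (y i == y j) = (i == j) by rewrite eq_rshift (inj_eq lift_inj).
have eqyz i : (y i == z) = false by rewrite eq_rshift.
apply: tzyP => [i||i]; rewrite mnmDE mnm_sumE tzyE mnm1E ?mnmE.
- by rewrite [z == _]eq_rlshift big1 // => j _; rewrite mnm1E eqyt.
- by rewrite eqxx big1 // => j _; rewrite mnm1E eqyz.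
- rewrite eq_sym eqyz (bigD1 i) //= big1 => [|j nij]; rewrite mnm1E eqyy ?eqxx //.
  by rewrite (negPf nij).
Qed.

(** The grading of [K[t, z, y]] for which [z y_1 .. y_m] and all [y_i t_i] have
weight 0. *)
Definition tweight u : {ffun 'I_m -> int} :=
  [ffun i => (u (y i))%:Z - (u (t i))%:Z - (u z)%:Z].

Lemma tweightD u v : tweight (u + v)%MM = tweight u + tweight v.
Proof.
apply/ffunP => i; rewrite !ffunE !mnmDE !PoszD !opprD.
by rewrite [X in X + _ = _]addrACA [LHS]addrACA.
Qed.

(** The component of weight [c], evaluated at [y = z = 1]. *)
Definition tcomp (c : {ffun 'I_m -> int}) :=
  monom_lin (fun u => (tweight u == c)%:R *: 'X_[K, tpart u]).

HB.instance Definition _ c := GRing.Linear.copy (tcomp c) (monom_lin _).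

Lemma tcompX c u : tcomp c 'X_[u] = (tweight u == c)%:R *: 'X_[tpart u].
Proof. exact: monom_linX. Qed.

(** Multiplying by a monomial shifts the weights: this is what makes the preimage
of an ideal under all the maps [tcomp c] an ideal. *)
Lemma tcompXM c u p : tcomp c ('X_[u] * p) = 'X_[tpart u] * tcomp (c - tweight u) p.
Proof.
elim/mpolyind: p => [|k v p _ _ IH]; first by rewrite mulr0 !linear0 mulr0.
rewrite mulrDr !linearD /= mulrDr IH; congr (_ + _).
rewrite -scalerAr !linearZ /= -scalerAr -mpolyXD !tcompX -scalerAr -mpolyXD.
by rewrite -tpartD tweightD [X in (X == c)%:R]addrC -[in RHS]subr_eq opprK.
Qed.

Lemma tcomp_twist c g : tcomp c (twist g) = (c == 0)%:R *: g.
Proof.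
elim/mpolyind: g => [|k a g _ _ IH].
  by rewrite /twist mmap0 linear0 scaler0.
rewrite /twist mmapD mmapZ -!/(twist _) mul_mpolyC twistX linearD linearZ /=.
rewrite IH tcompX scalerDr; congr (_ + _).
rewrite tpart_tzy !scalerA mulrC; congr (_%:R * _ *: _).
rewrite eq_sym; congr (_ == _ : nat).
by apply/ffunP => i; rewrite !ffunE !tzyE subrr subr0.
Qed.

Lemma tcomp_yz_unit c : tcomp c (@yz_unit K m) = 0.
Proof.
rewrite yz_unitE -mpolyX0 linearB /= !tcompX tpart_tzy.
have -> : tpart 0%MM = 0%MM by apply/mnmP => i; rewrite !mnmE.
have -> : tweight (tzy 0 1 [multinom 1%N | _ < m]) = tweight 0%MM.
  by apply/ffunP => i; rewrite !ffunE !tzyE !mnmE.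
by rewrite subrr.
Qed.

Section TwistIdeal.
Variable Ls : seq {mpoly K[m]}.

Local Notation L := (left_ideal_gen (fun g => g \in Ls)).
Local Notation J :=
  (left_ideal_gen (fun p => p \in yz_unit K m :: [seq twist g | g <- Ls])).

(** The polynomials all of whose components evaluate into [L] form an ideal, which
contains the generators of [J]. *)
Lemma tcomp_ideal p c : J p -> L (tcomp c p).
Proof.
have [L0 LD LM] : left_ideal L := left_ideal_gen_ideal _.
move=> Jp; move: c; apply: (Jp (fun p => forall c, L (tcomp c p))) => {p Jp}.
2: move=> _ /[1!inE]/orP[/eqP->|/mapP[g gLs ->]] c.
- split=> [c|p q Lp Lq c|p q Lq]; rewrite ?linear0 ?linearD //.
    exact: LD (Lp c) (Lq c).
  elim/mpolyind: p => [|k u p _ _ IH] c; first by rewrite mul0r linear0.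
  rewrite mulrDl linearD; apply: LD (IH c).
  by rewrite -scalerAl linearZ /= -mul_mpolyC tcompXM; exact: LM _ _ (LM _ _ (Lq _)).
- by rewrite tcomp_yz_unit.
- by rewrite tcomp_twist -mul_mpolyC; apply: LM => I _; apply.
Qed.

Lemma twist_ideal g : L g -> J (twist g).
Proof.
have [J0 JD JM] : left_ideal J := left_ideal_gen_ideal _.
move=> Lg; apply: (Lg (fun g => J (twist g))) => [|h hLs I _]; last first.
  by apply; rewrite inE map_f ?orbT.
have twM : {morph @twist K m : p q / p * q} by move=> p q; apply: rmorphM.
split=> [|p q Jp Jq|p q Jq]; first by rewrite /twist mmap0.
  by rewrite /twist mmapD; apply: JD.
by rewrite twM; apply: JM.
Qed.

(** Modulo [J], [z y_1 .. y_m] is 1. *)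
Lemma yz_unit_cancel k p :
  J ('X_[tzy 0 k [multinom k | _ < m]] * p) -> J p.
Proof.
have idJ : left_ideal J := left_ideal_gen_ideal _; have [J0 JD JM] := idJ.
elim: k => [|k IH] Jp; last apply: IH.
  by move: Jp; rewrite (_ : tzy _ _ _ = 0%MM) ?mpolyX0 ?mul1r //;
     apply: tzyP => [i||i]; rewrite tzyE !mnmE.
have -> : 'X_[tzy 0 k [multinom k | _ < m]] * p =
    'X_[tzy 0 k.+1 [multinom k.+1 | _ < m]] * p
    - 'X_[tzy 0 k [multinom k | _ < m]] * p * yz_unit K m.
  rewrite yz_unitE mulrBr mulr1 opprB mulrAC -mpolyXD tzyD addm0 addn1.
  rewrite (_ : ([multinom k | _ < m] + _)%MM = [multinom k.+1 | _ < m]).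
    by rewrite addrC subrK.
  by apply/mnmP => i; rewrite mnmDE !mnmE addn1.
apply: (ideal_mpolyB idJ Jp); apply: JM => I _; apply; exact: mem_head.
Qed.

(** Multiply the twist [y^a t^a] up to [(z y_1 .. y_m)^k t^a], with [k] at least
each [a i], and cancel. *)
Lemma monom_twist_ideal a : L 'X_[a] -> J 'X_[tzy a 0 0%MM].
Proof.
have [J0 JD JM] : left_ideal J := left_ideal_gen_ideal _.
move/twist_ideal; rewrite twistX => Ja; apply: (@yz_unit_cancel (mdeg a)).
rewrite -mpolyXD tzyD add0m addm0 addn0.
pose b := [multinom (mdeg a - a i)%N | i < m].
suff -> : tzy a (mdeg a) [multinom mdeg a | _ < m]
        = (tzy 0 (mdeg a) b + tzy a 0 a)%MM.
  by rewrite mpolyXD; apply: JM.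
rewrite tzyD add0m addn0; congr tzy; apply/mnmP => i; rewrite mnmDE !mnmE subnK //.
by rewrite mdegE (bigD1 i) //= leq_addr.
Qed.

Lemma groebner_bmi_halts : halts (groebner_bmi Ls).
Proof.
have [G retG] := buchberger_halts (@yzblock m) (yz_unit K m :: [seq twist g | g <- Ls]).
by eexists; apply: returns_bind retG _; apply: returns_now.
Qed.

Lemma groebner_bmi_correct E : returns (groebner_bmi Ls) E ->
  (forall a, a \in E -> L 'X_[a]) /\
  (forall a, L 'X_[a] -> exists2 e, e \in E & (e <= a)%MM).
Proof.
move=> ret; have [G retG retE] := returns_bindE ret; rewrite (returns_nowE retE).
have [JG leadG] := buchberger_correct retG.
set GE := [seq g <- G | _]; split=> a.
  case/flattenP=> _ /mapP[g + ->] /mapP[u ug ->]; rewrite mem_filter.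
  case/andP=> /allP g0 /JG Jg.
  have gE v : v \in msupp g -> v = tzy (tpart v) 0 0%MM.
    by move/g0/eqP; apply: yzblock_deg0.
  (* Of the terms of [g], only the one at [u] has the weight of [u]. *)
  have := tcomp_ideal (tweight u) Jg; rewrite [g in tcomp _ g]mpolyE linear_sum /=.
  rewrite (bigD1_seq u) ?msupp_uniq //= big_seq_cond big1 => [|v /andP[vg neq_vu]].
    have idL : left_ideal L := left_ideal_gen_ideal _.
    rewrite linearZ /= tcompX eqxx scale1r addr0 => /(ideal_mpolyZ (g@_u)^-1 idL).
    by rewrite scalerA mulVf -?mcoeff_msupp // scale1r.
  rewrite linearZ /= tcompX; case: eqP => [wvu|_]; last by rewrite scale0r scaler0.
  case/eqP: neq_vu; rewrite (gE v vg) (gE u ug); congr tzy; apply/mnmP => i.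
  move/ffunP/(_ i): wvu; rewrite !ffunE (gE v vg) (gE u ug) !tzyE.
  rewrite !mnm0E !subr0 !sub0r !tpart_tzy.
  by move/oppr_inj => -[].
move/monom_twist_ideal/leadG => [|g [gG g0]].
  by rewrite -msupp_eq0 msuppX.
have -> : elim_lead (@yzblock m) ('X_[tzy a 0 0%MM] : {mpoly K[m + m.+1]})
        = tzy a 0 0%MM.
  apply: elim_leadP; first by rewrite mcoeffX eqxx oner_neq0.
  by move=> v; rewrite msuppX inE => /eqP->; apply: elim_le_refl.
(* The leading monomial of [g] divides [t^a], so it has block degree 0; by the
   elimination order so have all the monomials of [g]. *)
move=> leg; exists (tpart (elim_lead (@yzblock m) g)).
  apply/flattenP; exists [seq tpart u | u <- msupp g]; last first.
    exact/map_f/elim_lead_supp.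
  apply/mapP; exists g => //; rewrite mem_filter gG andbT; apply/allP => v vg.
  have ledv := elim_le_deg (elim_le_lead (@yzblock m) vg).
  rewrite -leqn0 -(tpart_deg0 a); apply: leq_trans ledv _.
  exact: block_deg_le.
apply/mnm_lepP => i; rewrite mnmE -(tzy_t a 0 0%MM).
by move/mnm_lepP: leg; apply.
Qed.

End TwistIdeal.

End Twist.

(** * Monomial ideals of the quotient by the kernel *)

Section Residues.
Variables (K : fieldType) (A : algType K) (m : nat) (f : 'I_m -> A).
Hypothesis hf : pairwise_commuting f.
Implicit Types (p q : {mpoly K[m]}) (a e : 'X_{1..m}).

Lemma residueD p q : residue hf (p + q) = residue hf p + residue hf q.
Proof. exact: rmorphD. Qed.

Lemma residueM p q : residue hf (p * q) = residue hf p * residue hf q.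
Proof. exact: rmorphM. Qed.

Lemma residue0 : residue hf 0 = 0.
Proof. exact: rmorph0. Qed.

Lemma residue_surj (x : R_psi hf) : exists p, x = residue hf p.
Proof. by exists (repr x); rewrite /residue reprK. Qed.

Lemma residue_eqP p q : residue hf p = residue hf q <-> psi f (p - q) = 0.
Proof.
split=> [/eqP|/eqP pq]; last apply/eqP; rewrite -Quotient.idealrBE //.
by move/eqP.
Qed.

Lemma residue_eq0 p : residue hf p = 0 <-> psi f p = 0.
Proof. by rewrite -residue0 residue_eqP subr0. Qed.

Lemma residue_dvd_monom (M : R_psi hf -> Prop) e a :
  left_ideal M -> M (residue hf 'X_[e]) -> (e <= a)%MM -> M (residue hf 'X_[a]).
Proof. by case=> _ _ MM Me lea; rewrite -(submK lea) mpolyXD residueM; apply: MM. Qed.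

Lemma monomial_ideal_gen_in (E : 'X_{1..m} -> Prop) e :
  E e -> monomial_ideal_gen (hf := hf) E (residue hf 'X_[e]).
Proof. by move=> Ee J _; apply; exists e. Qed.

Section IdealContainingKernel.
Variable L : {mpoly K[m]} -> Prop.
Hypotheses (idL : left_ideal L) (kerL : forall p, psi f p = 0 -> L p).

Lemma ideal_residuesE p : ideal_residues (hf := hf) L (residue hf p) <-> L p.
Proof.
split=> [[q Lq /residue_eqP pq0]|Lp]; last by exists p.
by rewrite -(subrK q p); case: idL => _ LD _; apply: LD => //; apply: kerL.
Qed.

Lemma ideal_residues_ideal : left_ideal (ideal_residues (hf := hf) L).
Proof.
case: idL => L0 LD LM; split.
- by exists 0; rewrite ?residue0.
- move=> _ _ [p Lp ->] [q Lq ->].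
  by exists (p + q); rewrite ?residueD //; apply: LD.
- move=> x _ [p Lp ->]; have [q ->] := residue_surj x.
  by exists (q * p); rewrite ?residueM //; apply: LM.
Qed.

Lemma monom_in_monomial_subideal (N : R_psi hf -> Prop) :
  monomial_ideal N -> (forall x, N x -> ideal_residues L x) ->
  exists2 E : 'X_{1..m} -> Prop, forall e, E e -> L 'X_[e]
    & forall x, N x <-> monomial_ideal_gen E x.
Proof.
case=> E NE sNL; exists E => // e Ee.
by apply/ideal_residuesE; apply/sNL/NE; apply: monomial_ideal_gen_in.
Qed.

(** Every monomial in [L] is a multiple of one in [E], and a monomial subideal of
[L / ker psi] is generated by residue classes of monomials in [L]. *)
Lemma biggest_monomial_ideal_gen (E : 'X_{1..m} -> Prop) :
  (forall e, E e -> L 'X_[e]) ->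
  (forall a, L 'X_[a] -> exists2 e, E e & (e <= a)%MM) ->
  biggest_monomial_ideal (ideal_residues L) (monomial_ideal_gen (hf := hf) E).
Proof.
move=> EL LE; split; first by exists E.
  move=> x; apply; first exact: ideal_residues_ideal.
  by move=> _ [e Ee ->]; apply/ideal_residuesE/EL.
move=> N monN sNL x; have [E' E'L ->] := monom_in_monomial_subideal monN sNL.
have idM : left_ideal (monomial_ideal_gen (hf := hf) E) := left_ideal_gen_ideal _.
move=> E'x; apply: (E'x _ idM) => _ [a /E'L/LE[e Ee lea] ->].
exact: residue_dvd_monom idM (monomial_ideal_gen_in Ee) lea.
Qed.

(** A single monomial in [L] generates a monomial ideal contained in
[L / ker psi], hence in the biggest one. *)
Lemma monom_in_biggest (M : R_psi hf -> Prop) a :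
  biggest_monomial_ideal (ideal_residues L) M ->
  M (residue hf 'X_[a]) <-> L 'X_[a].
Proof.
case=> _ sML biggest; split=> [/sML/ideal_residuesE //|La].
apply: (biggest (monomial_ideal_gen (fun b => b = a))); first by exists (fun b => b = a).
  move=> x; apply; first exact: ideal_residues_ideal.
  by move=> _ [_ -> ->]; apply/ideal_residuesE.
exact: monomial_ideal_gen_in.
Qed.

End IdealContainingKernel.

Lemma groebner_bmi_procedure : biggest_monomial_ideal_procedure hf (@groebner_bmi K m).
Proof.
move=> Ls L kerL; split=> [|E retE]; first exact: groebner_bmi_halts.
have [EL LE] := groebner_bmi_correct retE.
apply: biggest_monomial_ideal_gen => //; first exact: left_ideal_gen_ideal.
by move=> p /eqP; apply: kerL.
Qed.

Lemma monoid_genP x : monoid_gen f x <-> exists a : 'X_{1..m}, x = psi f 'X_[a].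
Proof.
split=> [|[a ->]].
  elim=> [|i|_ _ _ [a ->] _ [b ->]].
  - by exists 0%MM; rewrite mpolyX0 psi1.
  - by exists U_(i)%MM; rewrite psiX.
  by exists (a + b)%MM; rewrite psi_monomD.
rewrite psi_monom; elim/big_ind: _ => [|y z|i _].
- exact: monoid_gen1.
- exact: monoid_genM.
elim: (a i) => [|k IH]; first exact: monoid_gen1.
by rewrite exprS; apply: monoid_genM IH; apply: monoid_gen_in.
Qed.

Lemma psi_kernel_ideal : left_ideal (fun p => psi f p = 0).
Proof.
split=> [|p q|p q]; first exact: psi0.
  by rewrite psiD => -> ->; rewrite addr0.
by rewrite psiM // => ->; rewrite mulr0.
Qed.

Lemma zero_ideal : left_ideal (fun x : R_psi hf => x = 0).
Proof. by split=> [//|x y -> ->|a x ->]; rewrite ?addr0 ?mulr0. Qed.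

End Residues.

(** * The intersection algorithm *)

Lemma returns_intersect_monoid (K : fieldType) (A : algType K) (m : nat)
    (f : 'I_m -> A) preimage bmi o :
  returns (intersect_monoid (K := K) f preimage bmi) o ->
  exists2 Ls, returns preimage Ls &
    all (fun g => psi f g == 0) Ls /\ o = None \/
    exists2 E, returns (bmi Ls) E &
      o = if all (fun a => psi f 'X_[a] == 0) E then None else Some E.
Proof.
move=> ret; have [Ls retLs reto] := returns_bindE ret; exists Ls => //.
case: ifP reto => [Ls0 reto|_ reto]; first by left; split=> //; apply: returns_nowE.
right; have [E retE {}reto] := returns_bindE reto; exists E => //.
by case: ifP reto => _; apply: returns_nowE.
Qed.

Theorem proposition14 (K : fieldType) (A : algType K) (I : A -> Prop)
    (m : nat) (f : 'I_m -> A)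
    (hI : left_ideal I) (hf : pairwise_commuting f)
    (h0 : ~ monoid_gen f 0) :
  biggest_monomial_ideal_procedure hf (@groebner_bmi K m) /\
  forall (preimage : delay (seq {mpoly K[m]}))
         (bmi : seq {mpoly K[m]} -> delay (seq 'X_{1..m})),
    computes_generators preimage (fun p => I (psi f p)) ->
    biggest_monomial_ideal_procedure hf bmi ->
    [/\ returns (intersect_monoid f preimage bmi) None ->
          forall a, ~ (I a /\ monoid_gen f a),
        forall E, returns (intersect_monoid f preimage bmi) (Some E) ->
          let M := monomial_ideal_gen (hf := hf) (fun a => a \in E) in
          (exists a, I a /\ monoid_gen f a) /\
          (forall a, I a /\ monoid_gen f a <->
             exists alpha : 'X_{1..m},
               a = \prod_(i < m) f i ^+ alpha i /\
               M (residue hf 'X_[alpha]))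
      & halts preimage -> halts (intersect_monoid f preimage bmi)].
Proof.
split=> [|preimage bmi preimageP bmiP]; first exact: groebner_bmi_procedure.
have psi_monom_neq0 a : psi f 'X_[K, a] <> 0.
  by move=> a0; apply: h0; apply/(monoid_genP hf); exists a.
have kerL Ls : returns preimage Ls ->
    forall p, psi f p = 0 -> left_ideal_gen (fun g => g \in Ls) p.
  by move=> retLs p p0; apply/(preimageP _ retLs); rewrite p0; case: hI.
have bmi_spec Ls : returns preimage Ls -> halts (bmi Ls) /\
    forall E, returns (bmi Ls) E -> forall a,
      monomial_ideal_gen (fun e => e \in E) (residue hf 'X_[a]) <-> I (psi f 'X_[a]).
  move=> retLs; have [p /eqP p0|halt bmi_big] := bmiP Ls; first exact: kerL.
  split=> // E /bmi_big biggest a; rewrite (preimageP _ retLs).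
  by apply: (monom_in_biggest (left_ideal_gen_ideal _) (kerL _ retLs)).
split.
- case/returns_intersect_monoid=> Ls retLs [[Ls0 _] x|[E retE]].
    case=> Ix /(monoid_genP hf)[a xE]; apply: (@psi_monom_neq0 a).
    have La : left_ideal_gen (fun g => g \in Ls) 'X_[a].
      by apply/(preimageP _ retLs); rewrite -xE.
    by apply: (La _ (psi_kernel_ideal hf)) => g /(allP Ls0)/eqP.
  case: allP => // E0 _ x [Ix /(monoid_genP hf)[a xE]]; apply: (@psi_monom_neq0 a).
  have /(_ a)[_ Ma] := (bmi_spec _ retLs).2 E retE.
  rewrite -xE in Ma; have {}Ma := Ma Ix.
  apply/(residue_eq0 hf); apply: (Ma _ (zero_ideal hf)) => _ [e /E0/eqP e0 ->].
  exact/residue_eq0.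
- move=> E' /returns_intersect_monoid[Ls retLs [[_ //]|[E retE]]].
  case: ifPn => // /allPn[e eE e0] [->] M {E'}.
  have MI a : M (residue hf 'X_[a]) <-> I (psi f 'X_[a]) := (bmi_spec _ retLs).2 E retE a.
  have psi_gen a : monoid_gen f (psi f 'X_[K, a]) by apply/(monoid_genP hf); exists a.
  split=> [|x].
    exists (psi f 'X_[e]); split=> //.
    by apply/MI; apply: monomial_ideal_gen_in.
  split=> [[Ix /(monoid_genP hf)[a xE]]|[a [-> Ma]]].
    by exists a; rewrite -(@psi_monom K) -xE MI -xE.
  by rewrite -(@psi_monom K) -MI.
case=> Ls retLs; case Ls0: (all (fun g => psi f g == 0) Ls).
  by exists None; apply: returns_bind retLs _; rewrite Ls0; apply: returns_now.
have [[E retE] _] := bmi_spec _ retLs.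
exists (if all (fun a => psi f 'X_[a] == 0) E then None else Some E).
apply: returns_bind retLs _; rewrite Ls0; apply: returns_bind retE _.
by case: ifP => _; apply: returns_now.
Qed.
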